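(* The point transformation $$x'=-\frac{x}{v^2},\qquad t'=t,\qquad u'=\frac{uv^3}{2x^2u-v},\qquad v'=\frac1v$$ maps the system $$v_x=ux,\qquad v_t=xu^{-2}u_x+\frac32u^{-1}$$ into itself, and it generates a cyclic group of order $2$. Moreover, the equation $$v_t=\left(\frac{x}{v_x}\right)^2v_{xx}+\frac12\frac{x}{v_x}$$ remains invariant under the point transformation $x'=-x/v^2$, $t'=t$, $v'=1/v$.
   Context: Subscripts denote partial derivatives. The system is the case $n=-2$, $\mu=-\frac12$ of the potential system $v_x=ux$, $v_t=xu^nu_x+\frac{\mu-1}{n+1}u^{n+1}$ associated with the porous medium equation $u_t=(u^nu_x)_x+\frac{\mu}{x}u^nu_x$; the scalar equation for $v$ is obtained by eliminating $u=v_x/x$. ''Maps the system into itself'' means: whenever $(u,v)$ are smooth functions on an open set $D$ on which $x,u,v,2x^2u-v$ are nowhere zero, such that $(x,t)\mapsto(-x/v(x,t)^2,t)$ is a diffeomorphism of $D$ onto an open set $D'$, and $(u',v')$ are the functions on $D'$ whose values at $(-x/v^2,t)$ are given by the formulas for $u',v'$, then $(u',v')$ satisfies the same system in the variables $(x',t')$ on $D'$ if and only if $(u,v)$ satisfies it on $D$. Invariance of the scalar equation is understood in the same way, with $x$, $v$, $v_x$ nowhere zero on $D$. ''Generates a cyclic group of order 2'' means that the transformation of $(x,t,u,v)$ is not the identity and composed with itself is the identity wherever defined. *)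

(* Defs.v *)
From Stdlib Require Import Reals.
From Coquelicot Require Import Coquelicot.

Open Scope R_scope.

(* Functions of (x, t) defined on an open set D of the plane are represented by
   total functions R * R -> R; only their values on D matter. *)

Definition partial_x (f : R * R -> R) (z : R * R) : R :=
  Derive (fun y => f (y, snd z)) (fst z).
Definition partial_t (f : R * R -> R) (z : R * R) : R :=
  Derive (fun s => f (fst z, s)) (snd z).

(* [Derive] is total with junk values, so existence has to be stated apart. *)
Definition ex_partial_x (f : R * R -> R) (z : R * R) : Prop :=
  ex_derive (fun y => f (y, snd z)) (fst z).
Definition ex_partial_t (f : R * R -> R) (z : R * R) : Prop :=
  ex_derive (fun s => f (fst z, s)) (snd z).

(* For open D this is C^oo on D: Coquelicot's [ex_diff_n f n x t] says that all
   iterated partial derivatives of order at most n exist and are jointly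
   continuous at (x, t). *)
Definition smooth_on (D : R * R -> Prop) (f : R * R -> R) : Prop :=
  forall (n : nat) (x t : R), D (x, t) -> ex_diff_n (fun y s => f (y, s)) n x t.

Definition smooth_map_on (D : R * R -> Prop) (F : R * R -> R * R) : Prop :=
  smooth_on D (fun z => fst (F z)) /\ smooth_on D (fun z => snd (F z)).

Definition diffeo (D D' : R * R -> Prop) (F : R * R -> R * R) : Prop :=
  smooth_map_on D F /\
  (forall z, D z -> D' (F z)) /\
  exists G : R * R -> R * R,
    smooth_map_on D' G /\
    (forall z, D' z -> D (G z)) /\
    (forall z, D z -> G (F z) = z) /\
    (forall z, D' z -> F (G z) = z).

(* Point transformations act on ((x, t), (u, v)), respectively ((x, t), v). *)

Definition sys_transf (p : (R * R) * (R * R)) : (R * R) * (R * R) :=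
  let '((x, t), (u, v)) := p in
  ((- x / v ^ 2, t), (u * v ^ 3 / (2 * x ^ 2 * u - v), 1 / v)).

Definition sys_transf_dom (p : (R * R) * (R * R)) : Prop :=
  let '((x, t), (u, v)) := p in v <> 0 /\ 2 * x ^ 2 * u - v <> 0.

Definition eqn_transf (p : (R * R) * R) : (R * R) * R :=
  let '((x, t), v) := p in ((- x / v ^ 2, t), 1 / v).

(* A partially defined transformation T with domain dom generates a cyclic group
   of order 2; T o T is defined at p when both dom p and dom (T p) hold. *)
Definition generates_order_two {A : Type} (dom : A -> Prop) (T : A -> A) : Prop :=
  ~ (forall p, dom p -> T p = p) /\
  (forall p, dom p -> dom (T p) -> T (T p) = p).

Definition solves_system (D : R * R -> Prop) (u v : R * R -> R) : Prop :=
  forall z, D z ->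
    let x := fst z in
    ex_partial_x u z /\ ex_partial_x v z /\ ex_partial_t v z /\
    partial_x v z = u z * x /\
    partial_t v z = x * / (u z) ^ 2 * partial_x u z + 3 / 2 * / u z.

Definition solves_equation (D : R * R -> Prop) (v : R * R -> R) : Prop :=
  forall z, D z ->
    let x := fst z in
    ex_partial_x v z /\ ex_partial_x (partial_x v) z /\ ex_partial_t v z /\
    partial_t v z = (x / partial_x v z) ^ 2 * partial_x (partial_x v) z + 1 / 2 * (x / partial_x v z).

(* Main.v *)
Require Import Defs.
From Stdlib Require Import Reals Lra.
From Coquelicot Require Import Coquelicot.

Open Scope R_scope.

(** The transformation fixes [t], so the induced map of the plane has the form
    [F (x, t) = (phi (x, t), t)] with [phi = - x / v ^ 2].  Because [F] has a
    differentiable inverse, [phi_x] vanishes nowhere, and for [f' o F = f] the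
    chain rule can be solved for the derivatives of [f']:
    [f'_x phi_x = f_x] and [f'_x phi_t + f'_t = f_t]
    ([transport_x], [transport_t]).  With [W = 2 x v_x - v] one has
    [phi_x = W / v ^ 3]; hence [W <> 0], and [v' o F = 1 / v] gives
    [v'_x = - v v_x / W] and [v'_t = v_t / (v W)] at the image point
    ([partials_v']).

    Write [U] for [2 x ^ 2 u - v].  The residual of the first equation of the
    system is then multiplied by the nonzero factor [v ^ 2 / (W U)].  Where the
    first equation holds, [U = W], and the residual of the second one is
    multiplied by [1 / (v W)].  Thus being a solution is equivalent, point by
    point, on the two sides ([system_at_transport]).

    The scalar equation for [v] is the system for the pair [(v_x / x, v)]
    ([system_at_iff_equation_at]).  The formula for [u'], applied to
    [u = v_x / x], yields [v'_x / x'], so the invariance of the equation follows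
    from that of the system.  The order of the transformation is a computation
    based on [2 x' ^ 2 u' - v' = 1 / U]. *)

(** * Differentiability of smooth functions *)

Definition differentiable_at (f : R * R -> R) (z : R * R) : Prop :=
  differentiable_pt_lim (fun y s => f (y, s)) (fst z) (snd z)
    (partial_x f z) (partial_t f z).

Lemma is_derive_partial_x (f : R * R -> R) (x t : R) :
  ex_partial_x f (x, t) ->
  is_derive (fun y => f (y, t)) x (partial_x f (x, t)).
Proof. intros H; exact (Derive_correct _ _ H). Qed.

Lemma is_derive_partial_t (f : R * R -> R) (x t : R) :
  ex_partial_t f (x, t) ->
  is_derive (fun s => f (x, s)) t (partial_t f (x, t)).
Proof. intros H; exact (Derive_correct _ _ H). Qed.

Lemma smooth_ex_partial (D : R * R -> Prop) (f : R * R -> R) (z : R * R) :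
  smooth_on D f -> D z ->
  ex_partial_x f z /\ ex_partial_t f z /\ ex_partial_x (partial_x f) z.
Proof.
intros Sf Dz; destruct z as [x t].
destruct (Sf 2%nat x t Dz) as (_ & Ex & Et & (_ & Exx & _) & _).
now split; [|split].
Qed.

(** The partial derivatives exist near [z], by openness of [D], and are
    continuous at [z]; this is what makes [f] jointly differentiable, as needed
    to differentiate along curves that are not parallel to an axis. *)
Lemma smooth_differentiable (D : R * R -> Prop) (f : R * R -> R) (z : R * R) :
  open D -> smooth_on D f -> D z -> differentiable_at f z.
Proof.
intros oD Sf Dz; destruct z as [x t].
apply filterdiff_differentiable_pt_lim.
refine (is_derive_filterdiff (fun y s => f (y, s)) x t
          (fun y s => partial_x f (y, s)) (partial_t f (x, t)) _ _ _).
- generalize (oD _ Dz); apply filter_imp; intros [y s] Dys.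
  now apply is_derive_partial_x; destruct (smooth_ex_partial D f (y, s) Sf Dys).
- now apply is_derive_partial_t; destruct (smooth_ex_partial D f (x, t) Sf Dz).
- destruct (Sf 1%nat x t Dz) as (_ & _ & _ & (Cx & _) & _).
  now apply continuity_2d_pt_filterlim in Cx.
Qed.

Lemma differentiable_at_comp (h : R -> R) (f : R * R -> R) (z : R * R) (l : R) :
  is_derive h (f z) l -> differentiable_at f z ->
  differentiable_at (fun w => h (f w)) z /\
  partial_x (fun w => h (f w)) z = l * partial_x f z /\
  partial_t (fun w => h (f w)) z = l * partial_t f z.
Proof.
intros Hh Hf; destruct z as [x t].
assert (H : differentiable_pt_lim (fun y s => h (f (y, s))) x t
  (l * partial_x f (x, t) + 0 * partial_x f (x, t))
  (l * partial_t f (x, t) + 0 * partial_t f (x, t))).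
{ apply (differentiable_pt_lim_comp (fun a _ => h a)
    (fun y s => f (y, s)) (fun y s => f (y, s))); try exact Hf.
  apply differentiable_pt_lim_proj1_0; now apply is_derive_Reals. }
destruct (differentiable_pt_lim_unique _ _ _ _ _ H) as [Ex Et].
assert (Ex' : partial_x (fun w => h (f w)) (x, t) = l * partial_x f (x, t)).
{ unfold partial_x at 1; simpl; rewrite Ex; ring. }
assert (Et' : partial_t (fun w => h (f w)) (x, t) = l * partial_t f (x, t)).
{ unfold partial_t at 1; simpl; rewrite Et; ring. }
split; [|now split].
unfold differentiable_at; rewrite Ex', Et'.
now rewrite !Rmult_0_l, !Rplus_0_r in H.
Qed.

Lemma differentiable_ex_partial (f : R * R -> R) (z : R * R) :
  differentiable_at f z -> ex_partial_x f z /\ ex_partial_t f z.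
Proof.
intros H; destruct z as [x t]; split.
- exists (partial_x f (x, t) * 1 + partial_t f (x, t) * 0); apply is_derive_Reals.
  apply (derivable_pt_lim_comp_2d (fun y s => f (y, s)) (fun y => y) (fun _ => t));
    [exact H | apply derivable_pt_lim_id | apply derivable_pt_lim_const].
- exists (partial_x f (x, t) * 0 + partial_t f (x, t) * 1); apply is_derive_Reals.
  apply (derivable_pt_lim_comp_2d (fun y s => f (y, s)) (fun _ => x) (fun s => s));
    [exact H | apply derivable_pt_lim_const | apply derivable_pt_lim_id].
Qed.

Lemma open_line_x (D : R * R -> Prop) (x t : R) :
  open D -> D (x, t) -> locally x (fun y => D (y, t)).
Proof.
intros oD Dz; destruct (oD _ Dz) as [e He]; exists e; intros y By.
apply He; split; [exact By | apply ball_center].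
Qed.

Lemma open_line_t (D : R * R -> Prop) (x t : R) :
  open D -> D (x, t) -> locally t (fun s => D (x, s)).
Proof.
intros oD Dz; destruct (oD _ Dz) as [e He]; exists e; intros y By.
apply He; split; [apply ball_center | exact By].
Qed.

(** * Transport of partial derivatives by a diffeomorphism preserving t *)

(** In the coordinates of [D'], the inverse of [F] is [(y, t) |-> (g y, t)] for
    fixed [t], so that [f' (y, t) = f (g y, t)] and [f'_x = g' f_x] by the chain
    rule in one variable.  Applied to the first component [phi] of [F], for which
    [f' = fst], the same identity reads [1 = g' phi_x]: this shows that [phi_x]
    is nonzero and eliminates [g'].  Only the existence of [f_x] is assumed on
    [f], so that a quotient involving [v_x] can be transported without a proof of
    its smoothness. *)
Lemma transport_x (D D' : R * R -> Prop) (F : R * R -> R * R) (z : R * R) :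
  open D -> open D' -> diffeo D D' F -> (forall w, snd (F w) = snd w) -> D z ->
  partial_x (fun w => fst (F w)) z <> 0 /\
  forall f f' : R * R -> R, (forall w, D w -> f' (F w) = f w) ->
    ex_partial_x f z ->
    ex_partial_x f' (F z) /\
    partial_x f' (F z) * partial_x (fun w => fst (F w)) z = partial_x f z.
Proof.
intros oD oD' ([SF _] & DF & G & [SG _] & DG & GF & FG) Fs Dz.
assert (D'z := DF z Dz); assert (Gz := GF z Dz); assert (Fz := Fs z).
destruct (F z) as [x' t'] eqn:E; destruct z as [x t]; simpl in Fz; subst t'.
assert (Gx := proj1 (smooth_ex_partial _ _ _ SG D'z)).
apply is_derive_partial_x in Gx.
set (g := fun y => fst (G (y, t))); set (gx := partial_x _ _) in Gx.
change (is_derive g x' gx) in Gx.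
assert (gE : forall y, D' (y, t) -> G (y, t) = (g y, t)).
{ intros y Dy; unfold g; assert (H := Fs (G (y, t))); rewrite (FG _ Dy) in H.
  now apply injective_projections. }
assert (gx' : g x' = x) by (unfold g; now rewrite Gz).
clearbody g.
assert (L := open_line_x _ _ _ oD' D'z).
assert (K : forall f f' : R * R -> R, (forall w, D w -> f' (F w) = f w) ->
  ex_partial_x f (x, t) ->
  is_derive (fun y => f' (y, t)) x' (gx * partial_x f (x, t))).
{ intros f f' Hf Ef; assert (e : forall y, D' (y, t) -> f (g y, t) = f' (y, t)).
  { intros y Dy; rewrite <- (gE _ Dy), <- (Hf _ (DG _ Dy)), (FG _ Dy); reflexivity. }
  apply is_derive_ext_loc with (fun y => f (g y, t)).
  - revert L; apply filter_imp; exact e.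
  - apply (is_derive_comp (fun y => f (y, t)) g); [|exact Gx].
    rewrite gx'; now apply is_derive_partial_x. }
assert (J : gx * partial_x (fun w => fst (F w)) (x, t) = 1).
{ assert (H := K (fun w => fst (F w)) fst (fun w _ => eq_refl)
    (proj1 (smooth_ex_partial _ _ _ SF Dz))).
  apply is_derive_unique in H; rewrite <- H; exact (Derive_id x'). }
split; [intros H; rewrite H in J; lra|].
intros f f' Hf Ef; assert (H := K f f' Hf Ef); split; [eexists; exact H|].
replace (partial_x f' (x', t)) with (gx * partial_x f (x, t))
  by (symmetry; exact (is_derive_unique _ _ _ H)).
transitivity (partial_x f (x, t) * (gx * partial_x (fun w => fst (F w)) (x, t)));
  [ring | rewrite J; ring].
Qed.

(** For fixed [x'], the inverse of [F] is [(x', s) |-> (g s, s)], a curve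
    transversal to the [x]-axis along which [f] has to be differentiated jointly:
    [f'_t = f_x g' + f_t].  For the first component [phi] of [F] the left-hand
    side is [0], whence [phi_x g' = - phi_t], which eliminates [g']. *)
Lemma transport_t (D D' : R * R -> Prop) (F : R * R -> R * R)
    (f f' : R * R -> R) (z : R * R) :
  open D -> open D' -> diffeo D D' F -> (forall w, snd (F w) = snd w) -> D z ->
  (forall w, D w -> f' (F w) = f w) -> differentiable_at f z ->
  ex_partial_t f' (F z) /\
  partial_x f' (F z) * partial_t (fun w => fst (F w)) z + partial_t f' (F z)
    = partial_t f z.
Proof.
intros oD oD' dF Fs Dz Hf df.
destruct (transport_x D D' F z oD oD' dF Fs Dz) as [J T].
destruct (T f f' Hf (proj1 (differentiable_ex_partial _ _ df))) as [_ Tx]; clear T.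
destruct dF as ([SF _] & DF & G & [SG _] & DG & GF & FG).
assert (D'z := DF z Dz); assert (Gz := GF z Dz); assert (Fz := Fs z).
destruct (F z) as [x' t'] eqn:E; destruct z as [x t]; simpl in Fz; subst t'.
assert (Gt := proj1 (proj2 (smooth_ex_partial _ _ _ SG D'z))).
apply is_derive_partial_t in Gt.
set (g := fun s => fst (G (x', s))); set (gt := partial_t _ _) in Gt.
change (is_derive g t gt) in Gt.
assert (gE : forall s, D' (x', s) -> G (x', s) = (g s, s)).
{ intros s Dy; unfold g; assert (H := Fs (G (x', s))); rewrite (FG _ Dy) in H.
  now apply injective_projections. }
assert (gt' : g t = x) by (unfold g; now rewrite Gz).
clearbody g.
assert (L := open_line_t _ _ _ oD' D'z).
assert (K : forall h h' : R * R -> R, (forall w, D w -> h' (F w) = h w) ->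
  differentiable_at h (x, t) ->
  is_derive (fun s => h' (x', s)) t
    (partial_x h (x, t) * gt + partial_t h (x, t) * 1)).
{ intros h h' Hh Eh; assert (e : forall s, D' (x', s) -> h (g s, s) = h' (x', s)).
  { intros s Ds; rewrite <- (gE _ Ds), <- (Hh _ (DG _ Ds)), (FG _ Ds); reflexivity. }
  apply is_derive_ext_loc with (fun s => h (g s, s)).
  - revert L; apply filter_imp; exact e.
  - apply is_derive_Reals.
    apply (derivable_pt_lim_comp_2d (fun y s => h (y, s)) g (fun s => s)).
    + rewrite gt'; exact Eh.
    + now apply is_derive_Reals.
    + apply derivable_pt_lim_id. }
assert (I : partial_x (fun w => fst (F w)) (x, t) * gt
            + partial_t (fun w => fst (F w)) (x, t) = 0).
{ assert (H := K (fun w => fst (F w)) fst (fun w _ => eq_refl)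
    (smooth_differentiable D _ _ oD SF Dz)).
  apply is_derive_unique in H; rewrite Rmult_1_r in H.
  rewrite <- H; exact (Derive_const x' t). }
assert (H := K f f' Hf df); split; [eexists; exact H|].
replace (partial_t f' (x', t)) with (partial_x f (x, t) * gt + partial_t f (x, t) * 1)
  by (symmetry; exact (is_derive_unique _ _ _ H)).
rewrite <- Tx.
transitivity (partial_t f (x, t) + partial_x f' (x', t) *
  (partial_x (fun w => fst (F w)) (x, t) * gt
   + partial_t (fun w => fst (F w)) (x, t))); [ring | rewrite I; ring].
Qed.

(** * The point transformation and its derivatives *)

Lemma is_derive_x' (v : R -> R) (x p : R) :
  is_derive v x p -> v x <> 0 ->
  is_derive (fun y => - y / v y ^ 2) x ((2 * x * p - v x) / v x ^ 3).
Proof.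
intros Hv v0; assert (Dv : Derive (fun y => v y) _ = _) by exact (is_derive_unique _ _ _ Hv).
auto_derive; [repeat split; [now exists p | now apply (pow_nonzero _ 2)]|].
rewrite Dv; now field.
Qed.

Lemma is_derive_x'_fixed_x (v : R -> R) (x t q : R) :
  is_derive v t q -> v t <> 0 ->
  is_derive (fun s => - x / v s ^ 2) t (2 * x * q / v t ^ 3).
Proof.
intros Hv v0; assert (Dv : Derive (fun y => v y) _ = _) by exact (is_derive_unique _ _ _ Hv).
auto_derive; [repeat split; [now exists q | now apply (pow_nonzero _ 2)]|].
rewrite Dv; now field.
Qed.

Lemma is_derive_u' (u v : R -> R) (x q p : R) :
  is_derive u x q -> is_derive v x p -> 2 * x ^ 2 * u x - v x <> 0 ->
  is_derive (fun y => u y * v y ^ 3 / (2 * y ^ 2 * u y - v y)) x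
    (((q * v x ^ 3 + 3 * u x * v x ^ 2 * p) * (2 * x ^ 2 * u x - v x)
      - u x * v x ^ 3 * (4 * x * u x + 2 * x ^ 2 * q - p))
     / (2 * x ^ 2 * u x - v x) ^ 2).
Proof.
intros Hu Hv U0.
assert (Du : Derive (fun y => u y) _ = _) by exact (is_derive_unique _ _ _ Hu).
assert (Dv : Derive (fun y => v y) _ = _) by exact (is_derive_unique _ _ _ Hv).
auto_derive.
- repeat split; [now exists q | now exists p | now exists q | now exists p | exact U0].
- rewrite Du, Dv; field; exact U0.
Qed.

(** [W] is, up to the factor [1 / v ^ 3], the derivative [phi_x] of a
    diffeomorphism preserving [t], whence its nonvanishing; the rest is the chain
    rule for [1 / v]. *)
Lemma partials_v' (D D' : R * R -> Prop) (F : R * R -> R * R)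
    (v v' : R * R -> R) (z : R * R) :
  open D -> open D' -> smooth_on D v -> diffeo D D' F ->
  (forall w, F w = (- fst w / v w ^ 2, snd w)) ->
  (forall w, D w -> v w <> 0) ->
  (forall w, D w -> v' (F w) = / v w) ->
  D z ->
  let W := 2 * fst z * partial_x v z - v z in
  W <> 0 /\
  partial_x (fun w => fst (F w)) z = W / v z ^ 3 /\
  ex_partial_x v' (F z) /\ ex_partial_t v' (F z) /\
  partial_x v' (F z) = - v z * partial_x v z / W /\
  partial_t v' (F z) = partial_t v z / (v z * W).
Proof.
intros oD oD' Sv dF FE v0 Hv Dz W.
assert (Fs : forall w, snd (F w) = snd w) by (intros w; now rewrite FE).
assert (vz := v0 z Dz).
destruct (smooth_ex_partial D v z Sv Dz) as (Ex & Et & _).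
assert (dv := smooth_differentiable D v z oD Sv Dz).
destruct (differentiable_at_comp Rinv v z (- / v z ^ 2)) as (di & ix & it);
  [|exact dv|].
{ auto_derive; [easy | now field]. }
assert (px : partial_x (fun w => fst (F w)) z = W / v z ^ 3).
{ destruct z as [x t]; unfold partial_x at 1; simpl.
  rewrite (Derive_ext _ (fun y => - y / v (y, t) ^ 2)) by (intros; now rewrite FE).
  apply is_derive_unique, (is_derive_x' (fun y => v (y, t))); [|exact vz].
  now apply is_derive_partial_x. }
assert (pt : partial_t (fun w => fst (F w)) z
  = 2 * fst z * partial_t v z / v z ^ 3).
{ destruct z as [x t]; unfold partial_t at 1; simpl.
  rewrite (Derive_ext _ (fun s => - x / v (x, s) ^ 2)) by (intros; now rewrite FE).
  apply is_derive_unique, (is_derive_x'_fixed_x (fun s => v (x, s))); [|exact vz].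
  now apply is_derive_partial_t. }
destruct (transport_x D D' F z oD oD' dF Fs Dz) as [J T].
assert (W0 : W <> 0).
{ intros H; apply J; rewrite px, H; now field. }
destruct (T _ _ Hv (proj1 (differentiable_ex_partial _ _ di))) as [Ex' Tx].
destruct (transport_t D D' F _ _ z oD oD' dF Fs Dz Hv di) as [Et' Tt].
rewrite ix, px in Tx; rewrite it, pt in Tt.
assert (Px : partial_x v' (F z) = - v z * partial_x v z / W).
{ apply Rmult_eq_reg_r with (W / v z ^ 3); [rewrite Tx; now field|].
  now rewrite <- px. }
repeat (split; [easy|]).
replace (partial_t v' (F z)) with (- / v z ^ 2 * partial_t v z
  - partial_x v' (F z) * (2 * fst z * partial_t v z / v z ^ 3))
  by (rewrite <- Tt; ring).
rewrite Px; unfold W; unfold W in W0; now field.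
Qed.

(** * Transport of the system and reduction of the scalar equation *)

(** The condition that [solves_system] imposes at one point; pointwise
    equivalences are available because both directions of the invariance come
    from proportionality of residuals at corresponding points. *)
Definition system_at (u v : R * R -> R) (z : R * R) : Prop :=
  ex_partial_x u z /\ ex_partial_x v z /\ ex_partial_t v z /\
  partial_x v z = u z * fst z /\
  partial_t v z = fst z * / (u z) ^ 2 * partial_x u z + 3 / 2 * / u z.

Definition equation_at (v : R * R -> R) (z : R * R) : Prop :=
  ex_partial_x v z /\ ex_partial_x (partial_x v) z /\ ex_partial_t v z /\
  partial_t v z = (fst z / partial_x v z) ^ 2 * partial_x (partial_x v) z
    + 1 / 2 * (fst z / partial_x v z).

Lemma eq_iff_of_proportional (a b c d k : R) :
  k <> 0 -> a - b = k * (c - d) -> a = b <-> c = d.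
Proof.
intros k0 H; split; intros E.
- apply Rminus_diag_uniq, (Rmult_eq_reg_l k); [|exact k0].
  now rewrite <- H, E, Rmult_0_r, Rminus_diag.
- apply Rminus_diag_uniq; rewrite H, E; ring.
Qed.

(** The two equations are handled one after the other: the residual of the second
    is proportional to its transform only modulo the first, which holds on one
    side exactly when it holds on the other. *)
Lemma system_at_transport (D D' : R * R -> Prop) (F : R * R -> R * R)
    (u v u' v' : R * R -> R) (z : R * R) :
  open D -> open D' -> smooth_on D v -> diffeo D D' F ->
  (forall w, F w = (- fst w / v w ^ 2, snd w)) ->
  (forall w, D w -> v w <> 0) ->
  (forall w, D w ->
     u' (F w) = u w * v w ^ 3 / (2 * fst w ^ 2 * u w - v w)) ->
  (forall w, D w -> v' (F w) = / v w) ->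
  D z -> ex_partial_x u z ->
  fst z <> 0 -> u z <> 0 -> 2 * fst z ^ 2 * u z - v z <> 0 ->
  system_at u' v' (F z) <-> system_at u v z.
Proof.
intros oD oD' Sv dF FE v0 Hu Hv Dz Eu x0 u0 U0.
assert (vz := v0 z Dz).
destruct (partials_v' D D' F v v' z oD oD' Sv dF FE v0 Hv Dz)
  as (W0 & px & Ex' & Et' & Px & Pt).
destruct (smooth_ex_partial D v z Sv Dz) as (Ex & Et & _).
set (f := fun w => u w * v w ^ 3 / (2 * fst w ^ 2 * u w - v w)).
assert (df : is_derive (fun y => f (y, snd z)) (fst z)
  (((partial_x u z * v z ^ 3 + 3 * u z * v z ^ 2 * partial_x v z)
     * (2 * fst z ^ 2 * u z - v z)
    - u z * v z ^ 3 * (4 * fst z * u z + 2 * fst z ^ 2 * partial_x u z - partial_x v z))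
   / (2 * fst z ^ 2 * u z - v z) ^ 2)).
{ destruct z as [x t].
  apply (is_derive_u' (fun y => u (y, t)) (fun y => v (y, t)));
    [now apply is_derive_partial_x | now apply is_derive_partial_x | exact U0]. }
assert (Fs : forall w, snd (F w) = snd w) by (intros w; now rewrite FE).
destruct (transport_x D D' F z oD oD' dF Fs Dz) as [_ T].
destruct (T f u' Hu) as [Eu' Tu]; [now eexists; exact df|].
assert (fx : partial_x f z = _) by exact (is_derive_unique _ _ _ df).
rewrite px, fx in Tu; clear T fx.
(* The proportionality factor is [v ^ 2 / (W U)]. *)
assert (first : partial_x v' (F z) = u' (F z) * fst (F z)
                <-> partial_x v z = u z * fst z).
{ apply eq_iff_of_proportional with
    (v z ^ 2 / ((2 * fst z * partial_x v z - v z) * (2 * fst z ^ 2 * u z - v z))).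
  - apply Rmult_integral_contrapositive_currified; [now apply pow_nonzero|].
    now apply Rinv_neq_0_compat, Rmult_integral_contrapositive_currified.
  - rewrite Px, (Hu z Dz), FE; simpl fst; field; now repeat split. }
assert (second : partial_x v z = u z * fst z ->
  partial_t v' (F z)
    = fst (F z) * / (u' (F z)) ^ 2 * partial_x u' (F z) + 3 / 2 * / u' (F z)
  <-> partial_t v z = fst z * / (u z) ^ 2 * partial_x u z + 3 / 2 * / u z).
{ intros E; rewrite E in *.
  set (W := 2 * fst z * (u z * fst z) - v z) in *.
  apply eq_iff_of_proportional with (/ (v z * W)).
  - now apply Rinv_neq_0_compat, Rmult_integral_contrapositive_currified.
  (* Make the product [u'_x phi_x], known from [Tu], appear. *)
  - replace (partial_x u' (F z)) with (partial_x u' (F z) * (W / v z ^ 3) * (v z ^ 3 / W))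
      by (field; now split).
    rewrite Tu, Pt, (Hu z Dz), FE; simpl fst; unfold W in *; field; now repeat split. }
unfold system_at; tauto.
Qed.

(** With [u = v_x / x] the first equation of the system is an identity, and
    [u_x = (x v_xx - v_x) / x ^ 2] turns the second into the scalar equation. *)
Lemma system_at_iff_equation_at (v : R * R -> R) (z : R * R) :
  fst z <> 0 -> partial_x v z <> 0 ->
  system_at (fun w => partial_x v w / fst w) v z <-> equation_at v z.
Proof.
intros x0 p0; set (u := fun w => partial_x v w / fst w).
assert (D : ex_partial_x (partial_x v) z ->
  is_derive (fun y => u (y, snd z)) (fst z)
    ((partial_x (partial_x v) z * fst z - partial_x v z) / fst z ^ 2)).
{ destruct z as [x t]; simpl in *; intros E; apply is_derive_partial_x in E.
  replace (_ / _) with ((partial_x (partial_x v) (x, t) * x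
    - partial_x v (x, t) * 1) / x ^ 2) by now field.
  apply (is_derive_div (fun y => partial_x v (y, t)) (fun y => y));
    [exact E | exact (is_derive_id (x : R_AbsRing)) | exact x0]. }
assert (Eu : ex_partial_x u z <-> ex_partial_x (partial_x v) z).
{ split; [intros E | now intros E; eexists; apply D].
  destruct z as [x t]; simpl in *.
  apply (ex_derive_ext_loc (fun y => y * u (y, t))).
  - assert (L := open_neq 0 x x0); revert L; apply filter_imp; intros y y0.
    unfold u; simpl; now field.
  - apply (ex_derive_mult (fun y => y)); [apply ex_derive_id | exact E]. }
assert (first : partial_x v z = u z * fst z) by (unfold u; now field).
assert (second : ex_partial_x (partial_x v) z ->
  fst z * / (u z) ^ 2 * partial_x u z + 3 / 2 * / u z
  = (fst z / partial_x v z) ^ 2 * partial_x (partial_x v) z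
    + 1 / 2 * (fst z / partial_x v z)).
{ intros E.
  assert (ux : partial_x u z = _) by exact (is_derive_unique _ _ _ (D E)).
  rewrite ux; unfold u; field; now split. }
unfold system_at, equation_at; split.
- intros (A & B & C & _ & H); rewrite second in H; tauto.
- intros (A & B & C & H); rewrite second; tauto.
Qed.

Lemma sys_transf_order_two : generates_order_two sys_transf_dom sys_transf.
Proof.
split.
- intros H; assert (K := H ((1, 0), (1, 1))); simpl in K.
  assert (E : - (1) / (1 * (1 * 1)) = 1).
  { refine (f_equal (fun p => fst (fst p)) (K _)); split; lra. }
  lra.
- intros [[x t] [u v]] [v0 U0] _; unfold sys_transf.
  assert (W' : 2 * (- x / v ^ 2) ^ 2 * (u * v ^ 3 / (2 * x ^ 2 * u - v)) - 1 / v
               = / (2 * x ^ 2 * u - v)) by (field; now split).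
  rewrite W'; repeat apply injective_projections; simpl fst; simpl snd;
    try reflexivity; field; repeat split; (assumption || lra).
Qed.

Theorem mainTheorem12 :
  (forall (D D' : R * R -> Prop) (u v u' v' : R * R -> R),
     open D -> open D' ->
     smooth_on D u -> smooth_on D v ->
     (forall z, D z ->
        fst z <> 0 /\ u z <> 0 /\ v z <> 0 /\ 2 * (fst z) ^ 2 * u z - v z <> 0) ->
     diffeo D D' (fun z => fst (sys_transf (z, (u z, v z)))) ->
     (forall z, D z ->
        let p' := sys_transf (z, (u z, v z)) in
        (u' (fst p'), v' (fst p')) = snd p') ->
     (solves_system D' u' v' <-> solves_system D u v))
  /\
  generates_order_two sys_transf_dom sys_transf
  /\
  (forall (D D' : R * R -> Prop) (v v' : R * R -> R),
     open D -> open D' ->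
     smooth_on D v ->
     (forall z, D z -> fst z <> 0 /\ v z <> 0 /\ partial_x v z <> 0) ->
     diffeo D D' (fun z => fst (eqn_transf (z, v z))) ->
     (forall z, D z ->
        let p' := eqn_transf (z, v z) in
        v' (fst p') = snd p') ->
     (solves_equation D' v' <-> solves_equation D v)).
Proof.
split; [|split; [exact sys_transf_order_two|]].
- intros D D' u v u' v' oD oD' Su Sv N0 dF Huv.
  set (F := fun z => fst (sys_transf (z, (u z, v z)))) in dF.
  assert (FE : forall w, F w = (- fst w / v w ^ 2, snd w)) by now intros [x t].
  assert (key : forall z, D z -> system_at u' v' (F z) <-> system_at u v z).
  { intros z Dz; destruct (N0 z Dz) as (x0 & u0 & _ & U0).
    apply (system_at_transport D D'); try assumption.
    - intros w Dw; apply (N0 w Dw).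
    - intros [x t] Dw; exact (f_equal fst (Huv _ Dw)).
    - intros [x t] Dw; rewrite <- Rdiv_1_l; exact (f_equal snd (Huv _ Dw)).
    - apply (smooth_ex_partial D u z Su Dz). }
  destruct dF as (_ & DF & G & _ & DG & _ & FG); split; intros S z Dz.
  + apply (key z Dz), S, (DF z Dz).
  + rewrite <- (FG z Dz); apply (key _ (DG z Dz)), S, (DG z Dz).
- intros D D' v v' oD oD' Sv N0 dF Hv'.
  set (F := fun z => fst (eqn_transf (z, v z))) in dF.
  assert (FE : forall w, F w = (- fst w / v w ^ 2, snd w)) by now intros [x t].
  assert (Hv : forall w, D w -> v' (F w) = / v w).
  { intros [x t] Dw; rewrite <- Rdiv_1_l; exact (Hv' _ Dw). }
  assert (v0 : forall w, D w -> v w <> 0) by (intros w Dw; apply (N0 w Dw)).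
  assert (key : forall z, D z -> equation_at v' (F z) <-> equation_at v z).
  { intros z Dz; destruct (N0 z Dz) as (x0 & vz & p0).
    assert (P := fun w Dw => partials_v' D D' F v v' w oD oD' Sv dF FE v0 Hv Dw).
    destruct (P z Dz) as (W0 & _ & _ & _ & Px & _).
    assert (N : forall a b, a <> 0 -> b <> 0 -> a / b <> 0).
    { intros a b Ha Hb; apply Rmult_integral_contrapositive_currified;
        [exact Ha | now apply Rinv_neq_0_compat]. }
    rewrite <- !system_at_iff_equation_at; try assumption.
    (* [v'_x / x'] is the transform of [v_x / x]. *)
    - apply (system_at_transport D D'); try assumption.
      + intros w Dw; destruct (N0 w Dw) as (wx0 & wv0 & _).
        destruct (P w Dw) as (Ww & _ & _ & _ & Pw & _).
        rewrite Pw, FE; simpl fst; field; now repeat split.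
      + destruct (smooth_ex_partial D v z Sv Dz) as (_ & _ & E).
        apply ex_derive_div; [exact E | apply ex_derive_id | exact x0].
      + now apply N.
      + intros H; apply W0; rewrite <- H; now field.
    - rewrite FE; simpl; apply N; [lra | now apply (pow_nonzero _ 2)].
    - rewrite Px; apply N; [|exact W0].
      apply Rmult_integral_contrapositive_currified; lra. }
  destruct dF as (_ & DF & G & _ & DG & _ & FG); split; intros S z Dz.
  + apply (key z Dz), S, (DF z Dz).
  + rewrite <- (FG z Dz); apply (key _ (DG z Dz)), S, (DG z Dz).
Qed.
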